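(* Let $\mathcal{S}$ and $\mathcal{T}$ be any domains (probability distributions) on $X\times Y$, $\mathcal{H}$ any set of voters, $\pi$ any (prior) probability distribution on $\mathcal{H}$, $\delta\in(0,1]$, and $b>0$, $c>0$ any real numbers. Put $$b'=\frac{b}{1-e^{-b}}\,\beta_\infty(\mathcal{T}\|\mathcal{S}),\qquad c'=\frac{c}{1-e^{-c}} .$$ Then, with probability at least $1-\delta$ over the choices of $S\sim(\mathcal{S})^{m_s}$ and $T\sim(\mathcal{T}_X)^{m_t}$, for all probability distributions $\rho$ on $\mathcal{H}$, $$R_{\mathcal{T}}(G_\rho)\ \le\ c'\,\tfrac12\,\widehat d_T(\rho)+b'\,\widehat e_S(\rho)+\eta_{\mathcal{T}\setminus\mathcal{S}}+\left(\frac{c'}{m_t\times c}+\frac{b'}{m_s\times b}\right)\Big(2\,\mathrm{KL}(\rho\|\pi)+\ln\tfrac2\delta\Big).$$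
   Context: Setting: $X\subseteq\mathbb{R}^d$, $Y=\{-1,1\}$; voters are functions $h:X\to Y$; $\mathcal{T}_X$ is the marginal of $\mathcal{T}$ on $X$; $m_s,m_t\ge1$ are integers; $P^m$ is the distribution of $m$ i.i.d. draws from $P$, and $(S,T)\sim(\mathcal{S})^{m_s}\times(\mathcal{T}_X)^{m_t}$. $\mathcal{S}$ and $\mathcal{T}$ are given by densities $\mathcal{S}(x,y)$, $\mathcal{T}(x,y)$ with respect to a common dominating measure, and $\mathrm{supp}(\mathcal{S})=\{(x,y):\mathcal{S}(x,y)>0\}$, and similarly for $\mathcal{T}$. All functions involved are assumed measurable. $I[a]=1$ if $a$ is true and $0$ otherwise. Risk: $R_P(h)=\mathbf{E}_{(x,y)\sim P}I[h(x)\ne y]$. Gibbs risk: $R_P(G_\rho)=\mathbf{E}_{(x,y)\sim P}\mathbf{E}_{h\sim\rho}I[h(x)\ne y]$. Empirical target disagreement, for $T=\{x'_i\}_{i=1}^{m_t}$: $\widehat d_T(\rho)=\frac1{m_t}\sum_{i=1}^{m_t}\mathbf{E}_{h\sim\rho}\mathbf{E}_{h'\sim\rho}I[h(x'_i)\ne h'(x'_i)]$. Empirical source joint error, for $S=\{(x_i,y_i)\}_{i=1}^{m_s}$: $\widehat e_S(\rho)=\frac1{m_s}\sum_{i=1}^{m_s}\mathbf{E}_{h\sim\rho}\mathbf{E}_{h'\sim\rho}I[h(x_i)\ne y_i]\,I[h'(x_i)\ne y_i]$. Divergence: $\beta_\infty(\mathcal{T}\|\mathcal{S})=\sup_{(x,y)\in\mathrm{supp}(\mathcal{S})}\frac{\mathcal{T}(x,y)}{\mathcal{S}(x,y)}$.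 If it is $+\infty$, the right-hand side of the bound is read as $+\infty$. $\mathcal{T}\setminus\mathcal{S}$ denotes the distribution of $(x,y)\sim\mathcal{T}$ conditional on $(x,y)\in\mathrm{supp}(\mathcal{T})\setminus\mathrm{supp}(\mathcal{S})$, and $\eta_{\mathcal{T}\setminus\mathcal{S}}=\Pr_{(x,y)\sim\mathcal{T}}\big((x,y)\notin\mathrm{supp}(\mathcal{S})\big)\,\sup_{h\in\mathcal{H}}R_{\mathcal{T}\setminus\mathcal{S}}(h)$, understood as $0$ when the probability factor is $0$. $\mathrm{KL}(\rho\|\pi)$ is the Kullback–Leibler divergence ($+\infty$ if $\rho$ is not absolutely continuous with respect to $\pi$). The prior $\pi$ is fixed independently of the samples. *)

(* Defs.v *)
From HB Require Import structures.
From mathcomp Require Import all_boot all_order all_algebra.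
From mathcomp Require Import all_classical all_reals all_analysis.

Set Implicit Arguments.
Unset Strict Implicit.
Unset Printing Implicit Defensive.
Import Order.TTheory GRing.Theory Num.Theory.
Import numFieldNormedType.Exports.

Local Open Scope classical_set_scope.
Local Open Scope ring_scope.
Local Open Scope ereal_scope.

(* A [measurableType] must be pointed, hence the nonemptiness argument: an
   arbitrary element is chosen as the point and is not used anywhere else. *)
Definition nonempty_subtype (T : Type) (A : set T) (_ : A !=set0) : Type := A.

Section nonempty_subtype_instances.
Context (T : Type) (A : set T) (A0 : A !=set0).

HB.instance Definition _ := gen_eqMixin (nonempty_subtype A0).
HB.instance Definition _ := gen_choiceMixin (nonempty_subtype A0).
HB.instance Definition _ :=
  isPointed.Build (nonempty_subtype A0) (SigSub (mem_set (projT2 (cid A0)))).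

End nonempty_subtype_instances.

(* The set [X], a subset of R^d, with the trace of the Borel sigma-algebra of
   R^d; [X] need not be Borel. The label set {-1, 1} is encoded by [bool]
   ([false] for -1, [true] for 1), with its discrete sigma-algebra. *)
Definition input_space (R : realType) (d : nat) (X : set (d.-tuple R))
    (X0 : X !=set0) :=
  g_sigma_algebra_preimageType
    (fun x : nonempty_subtype X0 => \val x : d.-tuple R).

(* The set of voters [H] with the sigma-algebra generated by [G]. Every
   sigma-algebra on [H] is obtained in this way, by taking it as [G]. *)
Definition voter_space (X : Type) (H : set (X -> bool)) (H0 : H !=set0)
    (G : set (set (nonempty_subtype H0))) :=
  g_sigma_algebraType G.

Definition vote (X : Type) (H : set (X -> bool)) (H0 : H !=set0)
    (G : set (set (nonempty_subtype H0))) (h : voter_space G) : X -> bool :=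
  \val (h : nonempty_subtype H0).

Section iid_draws.
Context d (T : measurableType d) (R : realType).

Definition tuple_cons (n : nat) (p : T * n.-tuple T) : n.+1.-tuple T :=
  [tuple of p.1 :: p.2].

Lemma measurable_tuple_cons (n : nat) :
  measurable_fun [set: T * n.-tuple T] (@tuple_cons n).
Proof. exact: measurable_cons. Qed.

HB.instance Definition _ (n : nat) :=
  isMeasurableFun.Build _ _ _ _ (@tuple_cons n) (@measurable_tuple_cons n).

Fixpoint iid (P : probability T R) (m : nat) : probability (m.-tuple T) R :=
  match m with
  | 0 => dirac [tuple]
  | n.+1 => distribution (P \x iid P n) (@tuple_cons n)
  end.

(* The event [A] is not required to be measurable: the claim is that it
   contains a measurable event of probability at least [p]. *)
Definition with_probability_at_least (P : probability T R) (p : R)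
    (A : set T) : Prop :=
  exists E : set T, [/\ measurable E, p%:E <= P E & E `<=` A].

(* Kullback-Leibler divergence KL(rho || pi) *)
Definition KL (rho pi : probability T R) : \bar R :=
  if `[< rho `<< pi >] then
    \int[rho]_x
      (ln (fine (Radon_Nikodym (charge_of_finite_measure rho) pi x)))%:E
  else +oo.

End iid_draws.

Section densities.
Context d (Z : measurableType d) (R : realType).

Definition is_density (mu : {measure set Z -> \bar R}) (P : probability Z R)
    (p : {mfun Z >-> R}) : Prop :=
  (forall z, (0 <= p z)%R) /\
  forall A, measurable A -> P A = \int[mu]_(z in A) (p z)%:E.

Definition supp (p : {mfun Z >-> R}) : set Z := [set z | (0 < p z)%R].

Lemma measurable_supp (p : {mfun Z >-> R}) : measurable (supp p).
Proof.
rewrite (_ : supp p = [set: Z] `&` p @^-1` `]0%R, +oo[%classic).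
  exact: measurable_funP.
by apply/seteqP; split => z /=; rewrite in_itv/= andbT => //; case.
Qed.

(* beta_oo(T || S), for the densities [t] of T and [s] of S; the supremum is
   over all points of supp(S), not an essential one. When it is +oo, so is
   every sum of nonnegative terms one of which is a positive multiple of it,
   such as (b' / (m b)) (2 KL(rho || pi) + ln (2 / delta)): no separate
   convention is needed for a bound that contains this term. *)
Definition beta_oo (t s : {mfun Z >-> R}) : \bar R :=
  ereal_sup [set (t z / s z)%:E | z in supp s].

(* [T] conditioned on supp(T) \ supp(S); when that set has [T]-probability 0,
   [mnormalize] returns the junk value [T]. *)
Definition target_minus_source (T : probability Z R) (t s : {mfun Z >-> R}) :
    probability Z R :=
  mnormalize (mrestr T (measurableD (measurable_supp t) (measurable_supp s))) T.

End densities.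

Section risks.
Context dX (X : measurableType dX) (R : realType).

HB.instance Definition _ :=
  isMeasurableFun.Build _ _ _ _ (@fst X bool) measurable_fst.

Definition marginal (P : probability (X * bool)%type R) : probability X R :=
  distribution P fst.

Definition risk (P : probability (X * bool)%type R) (h : X -> bool) : \bar R :=
  \int[P]_z (h z.1 != z.2)%:R%:E.

(* Pr_T(supp(S)^c) sup_{h in H} R_{T\S}(h);
   when the probability factor is 0 the product is 0, as [0 * x = 0] for every
   extended real [x]. *)
Definition eta_minus (T : probability (X * bool)%type R)
    (t s : {mfun (X * bool)%type >-> R}) (H : set (X -> bool)) : \bar R :=
  T (~` supp s) * ereal_sup [set risk (target_minus_source T t s) h | h in H].

(* [V] is the space of voters and [ev h x] the vote of [h] on [x]. *)
Context dV (V : measurableType dV) (ev : V -> X -> bool).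

Definition gibbs_risk (P : probability (X * bool)%type R)
    (rho : probability V R) : \bar R :=
  \int[P]_z \int[rho]_h (ev h z.1 != z.2)%:R%:E.

Definition emp_disagreement (m : nat) (T : m.-tuple X) (rho : probability V R) :
    \bar R :=
  (m%:R^-1)%:E * \sum_(i < m)
    \int[rho]_h \int[rho]_h' (ev h (tnth T i) != ev h' (tnth T i))%:R%:E.

Definition emp_joint_error (m : nat) (S : m.-tuple (X * bool)%type)
    (rho : probability V R) : \bar R :=
  (m%:R^-1)%:E * \sum_(i < m)
    \int[rho]_h \int[rho]_h'
      ((ev h (tnth S i).1 != (tnth S i).2)%:R *
       (ev h' (tnth S i).1 != (tnth S i).2)%:R)%:E.

End risks.

(* Main.v *)
(** Catoni's change-of-measure argument. For a {0,1}-valued loss A of a pair of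
    voters w, drawn on an example z, 1 - x <= exp (-x) shows that
    exp (sum_i ((1 - exp (-c)) P(A w) - c A(w, z_i))) has expectation at most 1
    over the sample; averaging over w ~ pi x pi and applying Markov's inequality
    bounds it by 1/e off an event of probability e, and the change of measure
    from pi x pi to rho x rho costs 2 KL(rho || pi). This is applied to the
    disagreement on the target (P = T_X) and to the joint error on the source
    (P = S), with e = delta / 2. The Gibbs risk is half the disagreement plus
    the joint error; the joint error under T is at most beta_oo times that
    under S on supp(S), and at most eta off supp(S). *)

Require Import Defs.
From HB Require Import structures.
From mathcomp Require Import all_boot all_order all_algebra.
From mathcomp Require Import all_classical all_reals all_analysis.
From mathcomp Require Import measurable_realfun.
From mathcomp Require Import ring lra.

Set Implicit Arguments.
Unset Strict Implicit.
Unset Printing Implicit Defensive.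
Import Order.TTheory GRing.Theory Num.Theory.
Import numFieldNormedType.Exports.

Local Open Scope classical_set_scope.
Local Open Scope ring_scope.
Local Open Scope ereal_scope.

(** * Change of measure between probabilities and the Kullback-Leibler divergence *)

Lemma integral_probability_cst d (T : measurableType d) (R : realType)
  (P : probability T R) (r : R) : \int[P]_x r%:E = r%:E.
Proof. by rewrite integral_cst// -[RHS]mule1 -(probability_setT P). Qed.

Lemma bounded_integrable d (T : measurableType d) (R : realType)
    (P : probability T R) (f : T -> R) (M : R) :
  measurable_fun [set: T] f -> (forall x, `|f x| <= M)%R ->
  P.-integrable [set: T] (EFin \o f).
Proof.
move=> mf fM; apply: measurable_bounded_integrable => //.
  by rewrite -ge0_fin_numE// fin_num_measure.
exists M; split; rewrite ?num_real// => x Mx y _.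
exact: le_trans (fM y) (ltW Mx).
Qed.

Section change_of_measure.
Context d (V : measurableType d) (R : realType).
Implicit Types rho pi : probability V R.

(* Where the Radon-Nikodym derivative is not positive, [l] is the junk value
   [ln r = 0]; this is a [rho]-null set. *)
Lemma KL_log_density rho pi : rho `<< pi ->
  exists l : V -> R, [/\ measurable_fun [set: V] l,
    KL rho pi = \int[rho]_v (l v)%:E &
    forall w : V -> R, measurable_fun [set: V] w -> (forall v, 0 <= w v)%R ->
      \int[rho]_v (w v * expR (- l v))%:E <= \int[pi]_v (w v)%:E].
Proof.
move=> rhopi.
pose g : V -> R := fun v =>
  fine (Radon_Nikodym (charge_of_finite_measure rho) pi v).
have mg : measurable_fun [set: V] g.
  by apply: measurableT_comp => //; exact: Radon_Nikodym_integrable.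
exists (fun v => ln (g v)); split.
- exact: measurableT_comp.
- by rewrite /KL asboolT.
move=> w mw w0.
(* [f] is a version of the density that is nonnegative everywhere and obeys the change of variables;
   it agrees with the derivative used in [KL] only [pi]-almost everywhere. *)
pose f := Radon_Nikodym_SigmaFinite.f rho pi.
have f0 v : 0 <= f v by exact: Radon_Nikodym_SigmaFinite.f_ge0.
have mf : measurable_fun [set: V] f.
  exact: measurable_int (Radon_Nikodym_SigmaFinite.f_integrable _).
have wl0 v : 0 <= (w v * expR (- ln (g v)))%:E.
  by rewrite lee_fin mulr_ge0// expR_ge0.
have mwl : measurable_fun [set: V] (fun v => (w v * expR (- ln (g v)))%:E).
  apply/measurable_EFinP; apply: measurable_funM => //.
  apply: measurableT_comp => //; apply: measurableT_comp => //.
  exact: measurableT_comp.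
rewrite -(Radon_Nikodym_SigmaFinite.change_of_variables rhopi)//.
have [N [mN piN0 subN]] := ae_eq_Radon_Nikodym_SigmaFinite rhopi measurableT.
apply: ae_ge0_le_integral => //.
- by move=> v _; rewrite mule_ge0//; exact: f0.
- exact: emeasurable_funM.
- by move=> v _; rewrite lee_fin.
- exact/measurable_EFinP.
exists N; split=> // v; apply: contra_notP => Nv _.
have fE : f v = (g v)%:E.
  rewrite /g fineK; last exact: Radon_Nikodym_fin_num.
  by apply: contra_notP Nv => Nv; apply: subN => /(_ I).
(* Where the density is 0 the left side vanishes, so only an inequality survives; elsewhere
   [expR (- ln (g v)) * g v = 1]. *)
have := f0 v; rewrite -/f fE lee_fin le_eqVlt => /predU1P[<-|g0].
  by rewrite mule0 lee_fin.
by rewrite -EFinM lee_fin expRN lnK ?posrE// divfK// gt_eqF.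
Qed.

(* Integrate [1 + u <= expR u] for [u := psi - l - ln K], where [l] is the
   log-density. *)
Lemma change_of_measure rho pi (psi : V -> R) (M K : R) :
  measurable_fun [set: V] psi -> (forall v, `|psi v| <= M)%R ->
  (0 < K)%R -> \int[pi]_v (expR (psi v))%:E <= K%:E ->
  \int[rho]_v (psi v)%:E <= KL rho pi + (ln K)%:E.
Proof.
move=> mpsi psiM K0 intK.
have [rhopi|nrhopi] := pselect (rho `<< pi); last first.
  by rewrite {1}/KL asboolF// addye// leey.
have [l [ml KLE lint]] := KL_log_density rhopi.
have [->|KLoo] := eqVneq (KL rho pi) +oo; first by rewrite addye// leey.
have mlN : measurable_fun [set: V] (fun v => expR (- l v)).
  by apply: measurableT_comp => //; exact: measurableT_comp.
have intpsi : rho.-integrable [set: V] (EFin \o psi).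
  exact: bounded_integrable psiM.
have intcst (r : R) : rho.-integrable [set: V] (EFin \o cst r).
  exact: finite_measure_integrable_cst.
have intexp : \int[rho]_v (expR (psi v) * expR (- l v))%:E <= K%:E.
  apply: le_trans intK; apply: lint; first exact: measurableT_comp.
  by move=> v; exact: expR_ge0.
(* The negative part of [l] is dominated by [expR (- l)], whose [rho]-integral is at most 1. Hence
   [l] fails to be integrable only if [KL] is [+oo]. *)
have intlN : \int[rho]_v (EFin \o l)^\- v <= 1.
  apply: (@le_trans _ _ (\int[rho]_v (1 * expR (- l v))%:E)).
    apply: ge0_le_integral => //.
    - by apply: measurable_funeneg; exact/measurable_EFinP.
    - by apply/measurable_EFinP; exact: measurable_funM.
    move=> v _; rewrite funenegE -EFinN -EFin_max lee_fin ge_max.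
    rewrite mul1r expR_ge0 andbT (le_trans _ (expR_ge1Dx _))//.
    by rewrite lerDr.
  apply: le_trans (lint (cst 1%R) _ _) _ => //=.
  by rewrite integral_probability_cst.
have intl : rho.-integrable [set: V] (EFin \o l).
  apply/integrableP; split; first exact/measurable_EFinP.
  rewrite -[X in integral _ _ X]/(abse \o _) fune_abse ge0_integralD//.
  - rewrite lte_add_pinfty//; last exact: le_lt_trans intlN (ltry _).
    rewrite ltey; apply: contra_neq KLoo => intoo.
    rewrite KLE integralE intoo addye//.
    by rewrite -ltNye lteNr (le_lt_trans intlN) ?ltry.
  - by apply: measurable_funepos; exact/measurable_EFinP.
  - by apply: measurable_funeneg; exact/measurable_EFinP.
have intexpl : rho.-integrable [set: V]
    (fun v => (expR (psi v) * expR (- l v))%:E).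
  apply/integrableP; split.
    apply/measurable_EFinP; apply: measurable_funM => //.
    exact: measurableT_comp.
  under eq_integral do rewrite gee0_abs ?lee_fin ?mulr_ge0 ?expR_ge0//.
  exact: le_lt_trans intexp (ltry _).
have intexpK := integrableZl measurableT K^-1 intexpl.
(* The added 1 is the one in [1 + u]; on the right it absorbs the integral of
   [K^-1 * expR (psi - l)], at most 1 by [intexp]. *)
rewrite -(@leeD2lE _ 1)//.
have -> : 1 + \int[rho]_v (psi v)%:E = \int[rho]_v (1 + (psi v)%:E).
  rewrite integralD//; last exact: (intcst 1%R).
  by rewrite integral_probability_cst.
apply: (@le_trans _ _ (\int[rho]_v
   (K^-1%:E * (expR (psi v) * expR (- l v))%:E + ((l v)%:E + (ln K)%:E)))).
  apply: le_integral => //.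
  - exact: (integrableD _ (intcst 1%R) intpsi).
  - apply: integrableD => //; apply: integrableD => //.
    exact: (intcst (ln K)).
  move=> v _ /=; rewrite -EFinM -!EFinD lee_fin.
  rewrite -lerBlDr.
  rewrite (le_trans _ (le_trans (expR_ge1Dx (psi v - l v - ln K)%R) _))//.
    by rewrite opprD !addrA.
  by rewrite !expRD !expRN lnK ?posrE// mulrC.
rewrite integralD//; last first.
  by apply: integrableD => //; exact: (intcst (ln K)).
rewrite integralD//; last exact: (intcst (ln K)).
rewrite integral_probability_cst -KLE leeD2r//.
by rewrite integralZl// lee_pdivrMl// mule1.
Qed.

(** Gibbs' inequality: the change of measure for the zero function. *)
Lemma KL_ge0 rho pi : 0 <= KL rho pi.
Proof.
have := @change_of_measure rho pi (cst 0%R) 0 1.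
rewrite integral_probability_cst ln1 adde0; apply => //.
- by move=> v; rewrite normr0.
- under eq_integral do rewrite expR0.
  by rewrite integral_probability_cst.
Qed.

End change_of_measure.

(** * Boolean functions as events *)

Lemma measurable_bool_set d (T : measurableType d) (A : T -> bool) :
  measurable_fun [set: T] A -> measurable [set x | A x].
Proof.
move=> mA; rewrite (_ : [set x | A x] = [set: T] `&` A @^-1` [set true]).
  exact: mA.
by rewrite setTI; apply/seteqP; split.
Qed.

Lemma measurable_natr_bool d (T : measurableType d) (R : realType)
    (A : T -> bool) : measurable_fun [set: T] A ->
  measurable_fun [set: T] (fun x => (A x)%:R : R).
Proof.
move=> mA; rewrite (_ : (fun x => _) = \1_[set x | A x]).
  by apply: measurable_indic; exact: measurable_bool_set.
apply/funext => x; rewrite indicE; congr (nat_of_bool _)%:R.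
by apply/idP/idP; rewrite inE.
Qed.

Lemma integral_bool d (T : measurableType d) (R : realType)
    (P : {measure set T -> \bar R}) (A : T -> bool) :
  measurable_fun [set: T] A -> \int[P]_x (A x)%:R%:E = P [set x | A x].
Proof.
move=> mA; rewrite -[X in P X]setIT -integral_indic//; last first.
  exact: measurable_bool_set.
apply: eq_integral => x _; rewrite indicE; congr ((nat_of_bool _)%:R%:E).
by apply/idP/idP; rewrite inE.
Qed.

(** * Change of measure for a pair of independent voters *)

Section change_of_measure_pair.
Context d (V : measurableType d) (R : realType).
Implicit Types rho pi : probability V R.

(* [change_of_measure] in the second voter, then in the first one, applied to
   the logarithm of the inner integral. *)
Lemma change_of_measure_pair rho pi (phi : V * V -> R) (M K : R) :
  measurable_fun [set: V * V] phi -> (forall w, `|phi w| <= M)%R ->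
  (0 < K)%R -> \int[pi \x pi]_w (expR (phi w))%:E <= K%:E ->
  \int[rho \x rho]_w (phi w)%:E <= 2%:E * KL rho pi + (ln K)%:E.
Proof.
move=> mphi phiM K0 intK.
have KL0 := KL_ge0 rho pi.
have [->|KLoo] := eqVneq (KL rho pi) +oo.
  by rewrite mulry gtr0_sg// mul1e addye// leey.
have KLfin : KL rho pi \is a fin_num by rewrite ge0_fin_numE// ltey.
have mexp : measurable_fun [set: V * V] (fun w => (expR (phi w))%:E).
  by apply/measurable_EFinP; exact: measurableT_comp.
have exp0 w : 0 <= (expR (phi w))%:E by rewrite lee_fin expR_ge0.
have mphi2 h : measurable_fun [set: V] (fun h' => phi (h, h')).
  exact: measurable_fun_pair2.
pose F h := \int[pi]_h' (expR (phi (h, h')))%:E.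
(* The bounds on [phi] pass to the inner integral, so its logarithm [psi] is again bounded by [M]
   and qualifies for the second change of measure. *)
have FM h : (expR (- M))%:E <= F h <= (expR M)%:E.
  have mexp2 : measurable_fun [set: V] (fun h' => (expR (phi (h, h')))%:E).
    exact: (measurable_fun_pair2 h mexp).
  rewrite -(integral_probability_cst pi (expR (- M))).
  rewrite -(integral_probability_cst pi (expR M)); apply/andP; split;
    apply: ge0_le_integral => // h' _; rewrite ?lee_fin ?expR_ge0// ler_expR.
    by have := phiM (h, h'); rewrite ler_norml => /andP[].
  by have := phiM (h, h'); rewrite ler_norml => /andP[].
have Ffin h : F h \is a fin_num.
  have /andP[F1 F2] := FM h; apply/fin_numPlt.
  by rewrite (lt_le_trans _ F1) ?ltNyr// (le_lt_trans F2) ?ltry.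
have F0 h : (0 < fine (F h))%R.
  have /andP[F1 _] := FM h; apply: lt_le_trans (expR_gt0 (- M)) _.
  by rewrite -lee_fin fineK.
have mF : measurable_fun [set: V] F.
  exact: (measurable_fun_fubini_tonelli_F _ mexp exp0).
pose psi h := ln (fine (F h)).
have mpsi : measurable_fun [set: V] psi.
  by apply: measurableT_comp => //; exact: measurableT_comp.
have psiM h : (`|psi h| <= M)%R.
  have /andP[F1 F2] := FM h; rewrite ler_norml.
  rewrite -(ler_expR (- M)%R) -(ler_expR (psi h)) lnK ?posrE//.
  by rewrite -(lee_fin (expR _)) -(lee_fin _ (expR _)) fineK// F1.
have intphi : (rho \x rho).-integrable [set: V * V] (EFin \o phi).
  exact: bounded_integrable phiM.
(* With [h] fixed, the constant is [K := F h], so the price [ln K] is [psi h]. *)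
have inner h : \int[rho]_h' (phi (h, h'))%:E <= KL rho pi + (psi h)%:E.
  apply: (@change_of_measure _ _ _ rho pi (fun h' => phi (h, h')) M) => //.
  by rewrite fineK.
(* Here [expR (psi h)] is [F h], and by Tonelli its [pi]-integral is the one over [pi \x pi]. *)
have outer : \int[rho]_h (psi h)%:E <= KL rho pi + (ln K)%:E.
  apply: change_of_measure => //; apply: le_trans intK.
  rewrite (fubini_tonelli1 _ mexp exp0) /fubini_F.
  apply: ge0_le_integral => //.
  - by apply/measurable_EFinP; exact: measurableT_comp.
  - by move=> h _; rewrite lnK ?posrE// fineK.
have intpsi : rho.-integrable [set: V] (EFin \o psi).
  exact: bounded_integrable psiM.
have intKL : rho.-integrable [set: V] (cst (KL rho pi)).
  rewrite -(fineK KLfin); exact: (finite_measure_integrable_cst rho (fine _)).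
rewrite -(integral12_prod_meas1 intphi).
apply: (@le_trans _ _ (\int[rho]_h (KL rho pi + (psi h)%:E))).
  apply: le_integral => //.
  - exact: (integrable_fubini_F intphi).
  - exact: integrableD.
  - by move=> h _; exact: inner.
rewrite integralD// -{1}(fineK KLfin) integral_probability_cst fineK//.
by rewrite -[2%R]/(1 + 1)%R EFinD muleDl// mul1e -addeA leeD2l.
Qed.

End change_of_measure_pair.

(** * Markov's inequality and products over i.i.d. draws *)

Lemma markov_event d (T : measurableType d) (R : realType)
    (Q : probability T R) (g : T -> \bar R) (e : R) :
  measurable_fun [set: T] g -> (forall x, 0 <= g x) -> (0 < e)%R ->
  \int[Q]_x g x <= 1 ->
  exists E, [/\ measurable E, (1 - e)%:E <= Q E &
    forall x, E x -> g x <= (e^-1)%:E].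
Proof.
move=> mg g0 e0 intg.
(* The inequality is strict so that the complement is exactly the set that Markov's inequality
   bounds. *)
pose E := [set x | g x < (e^-1)%:E].
have mE : measurable E.
  by rewrite -[E]setTI; exact: emeasurable_fun_infty_o.
exists E; split=> // [|x /ltW//].
have -> : E = ~` ~` E by rewrite setCK.
rewrite probability_setC; last exact: measurableC.
rewrite EFinB leeB//.
have ei0 : (0 < e^-1)%R by rewrite invr_gt0.
have := le_integral_abse Q measurableT mg ei0.
rewrite (eq_integral g); last by move=> x _; rewrite gee0_abs.
move=> /le_trans/(_ intg); rewrite setTI muleC lee_pdivrMr// mul1e.
suff -> : [set x | (e^-1)%:E <= `|g x|] = ~` E by [].
by apply/seteqP; split => x /=; rewrite gee0_abs// leNgt => /negP.
Qed.

Section iid_draws.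
Context d (Z : measurableType d) (R : realType).
Implicit Type P : probability Z R.

Lemma integral_iidS P (m : nat) (f : m.+1.-tuple Z -> \bar R) :
  measurable_fun [set: m.+1.-tuple Z] f -> (forall S, 0 <= f S) ->
  \int[iid P m.+1]_S f S =
  \int[P]_z \int[iid P m]_S f [tuple of z :: S].
Proof.
move=> mf f0; rewrite ge0_integral_distribution//.
have mf' := measurableT_comp mf (@measurable_tuple_cons _ Z m).
by rewrite (fubini_tonelli1 _ mf')// => q; exact: f0.
Qed.

(** By independence the mean of the product is the product of the means; the induction splits off
    the first draw and bounds the remaining factor by 1. *)
Lemma integral_iid_prod_le1 P (g : Z -> R) (m : nat) :
  measurable_fun [set: Z] g -> (forall z, 0 <= g z)%R ->
  \int[P]_z (g z)%:E <= 1 ->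
  \int[iid P m]_S (\prod_(i < m) g (tnth S i))%:E <= 1.
Proof.
move=> mg g0 intg.
have prod0 n (S : n.-tuple Z) : (0 <= \prod_(i < n) g (tnth S i))%R.
  by apply: prodr_ge0 => i _; exact: g0.
have mprod n :
    measurable_fun [set: n.-tuple Z] (fun S => \prod_(i < n) g (tnth S i))%R.
  apply: measurable_prod => i _; apply: measurableT_comp => //.
  exact: measurable_tnth.
elim: m => [|m IH].
  under eq_integral do rewrite big_ord0.
  by rewrite integral_probability_cst.
rewrite integral_iidS; last 2 first.
- by apply/measurable_EFinP; exact: mprod.
- by move=> S; rewrite lee_fin.
apply: le_trans intg; rewrite [X in X <= _](_ : _ = \int[P]_z ((g z)%:E *
    \int[iid P m]_S (\prod_(i < m) g (tnth S i))%:E)); last first.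
  apply: eq_integral => z _; rewrite -ge0_integralZl//; last 3 first.
  - by apply/measurable_EFinP; exact: mprod.
  - by move=> S _; rewrite lee_fin.
  - by rewrite lee_fin.
  apply: eq_integral => S _; rewrite big_ord_recl EFinM; congr (_ * _%:E).
  by apply: eq_bigr => i _; rewrite tnthS.
have I0 : 0 <= \int[iid P m]_S (\prod_(i < m) g (tnth S i))%:E.
  by apply: integral_ge0 => S _; rewrite lee_fin.
apply: ge0_le_integral => //.
- by move=> z _; rewrite mule_ge0// lee_fin.
- by apply: emeasurable_funM => //; exact/measurable_EFinP.
- exact/measurable_EFinP.
by move=> z _; rewrite -[leRHS]mule1 lee_wpmul2l// lee_fin.
Qed.

End iid_draws.

(** * Catoni's exponential moment and the PAC-Bayes bound for pairs of voters *)

Section catoni_bound.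
Context dZ (Z : measurableType dZ) dW (W : measurableType dW) (R : realType).
Implicit Types (P : probability Z R) (A : W * Z -> bool).

(* [E (expR (- c A)) = 1 - (1 - expR (- c)) P(A)], and [1 - x <= expR (- x)]. *)
Lemma integral_expR_bernoulli_le1 P (B : Z -> bool) (c : R) :
  measurable_fun [set: Z] B ->
  \int[P]_z (expR ((1 - expR (- c)) * fine (P [set z | B z]) -
                   c * (B z)%:R))%:E <= 1.
Proof.
move=> mB.
set p := fine _; set k : R := (1 - expR (- c))%R.
have mBR : measurable_fun [set: Z] (fun z => (B z)%:R : R).
  exact: measurable_natr_bool.
have intB : P.-integrable [set: Z] (fun z => (B z)%:R%:E).
  apply: (@bounded_integrable _ _ _ _ _ 1) => // z.
  by case: (B z); rewrite ?normr1 ?normr0.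
have pE : \int[P]_z (B z)%:R%:E = p%:E.
  rewrite integral_bool// fineK// fin_num_measure//.
  exact: measurable_bool_set.
(* For a value in {0,1}, [expR (- c B)] is the affine function [1 - k B], so its mean depends on [p]
   alone. *)
rewrite (eq_integral (fun z => (expR (k * p))%:E * (1 - k%:E * (B z)%:R%:E)));
  last first.
  move=> z _ /=; rewrite expRD -EFinD -EFinM; congr (_ * _)%:E.
  case: (B z); last by rewrite !mulr0 oppr0 expR0 addr0.
  by rewrite !mulr1 /k opprB addrC subrK.
have intkB : P.-integrable [set: Z] (fun z => k%:E * (B z)%:R%:E).
  exact: integrableZl.
have int1 : P.-integrable [set: Z] (cst 1).
  exact: (finite_measure_integrable_cst P 1%R).
rewrite integralZl//; last exact: integrableB.
rewrite integralB// integralZl// pE integral_probability_cst.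
rewrite -[X in X <= _]/((expR (k * p) * (1 - k * p))%:E) lee_fin.
apply: (@le_trans _ _ (expR (k * p) * expR (- (k * p)))%R).
  by rewrite ler_wpM2l ?expR_ge0// expR_ge1Dx.
by rewrite expRxMexpNx_1.
Qed.

(** The probability is kept inside the sum, so that the exponential factors into one term per
    draw. *)
Definition catoni_exponent P A (c : R) (m : nat) (S : m.-tuple Z) (w : W) : R :=
  (\sum_(i < m) ((1 - expR (- c)) * fine (P [set z | A (w, z)]) -
                 c * (A (w, tnth S i))%:R))%R.

Lemma measurable_prob_section P A : measurable_fun [set: W * Z] A ->
  measurable_fun [set: W] (fun w => P [set z | A (w, z)]).
Proof.
move=> mA.
have mAR : measurable_fun [set: W * Z] (fun q => (A q)%:R%:E : \bar R).
  by apply/measurable_EFinP; exact: measurable_natr_bool.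
rewrite (_ : (fun w => _) = fubini_F P (fun q => (A q)%:R%:E)).
  by apply: measurable_fun_fubini_tonelli_F => // q; rewrite lee_fin.
apply/funext => w; rewrite /fubini_F/= integral_bool//.
exact: (measurable_fun_pair2 w mA).
Qed.

Lemma measurable_catoni_exponent P A (c : R) (m : nat) :
  measurable_fun [set: W * Z] A ->
  measurable_fun [set: m.-tuple Z * W]
    (fun q => catoni_exponent P A c q.1 q.2).
Proof.
move=> mA; apply: measurable_sum => i; apply: measurable_funB.
  apply: measurable_funM => //.
  apply: (measurableT_comp (fine_measurable measurableT)).
  exact: (measurableT_comp (measurable_prob_section P mA) measurable_snd).
apply: measurable_funM => //; apply: measurable_natr_bool.
apply: (measurableT_comp mA); apply: measurable_fun_pair => //.
exact: (measurableT_comp (@measurable_tnth _ Z m i) measurable_fst).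
Qed.

(** Supplies the uniform bound in [w] that the change of measure requires. *)
Lemma catoni_exponent_bounded P A (c : R) (m : nat) (S : m.-tuple Z) (w : W) :
  measurable_fun [set: W * Z] A ->
  (`|catoni_exponent P A c S w| <= m%:R * (`|1 - expR (- c)| + `|c|))%R.
Proof.
move=> mA; rewrite (le_trans (ler_norm_sum _ _ _))//.
have mB : measurable [set z | A (w, z)].
  by apply: measurable_bool_set; exact: (measurable_fun_pair2 w mA).
rewrite mulr_natl -[X in (_ <= _ *+ X)%R](card_ord m) -sumr_const.
apply: ler_sum => i _.
rewrite (le_trans (ler_normB _ _))// !normrM lerD// ler_piMr//.
  rewrite ger0_norm ?fine_ge0// -lee_fin fineK//.
    exact: probability_le1.
  exact: fin_num_measure.
by case: (A _); rewrite ?normr1 ?normr0.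
Qed.

(** Markov's inequality for the [nu]-average of the exponential. As [nu] does not depend on the
    sample, Tonelli brings the sample expectation inside, where it is at most 1 for each [w]. The
    event is built from [nu] before any posterior is chosen. *)
Lemma catoni_event P (nu : probability W R) A (m : nat) (c e : R) :
  measurable_fun [set: W * Z] A -> (0 < e)%R ->
  exists E, [/\ measurable E, (1 - e)%:E <= iid P m E &
    forall S, E S ->
      \int[nu]_w (expR (catoni_exponent P A c S w))%:E <= (e^-1)%:E].
Proof.
move=> mA e0.
have mexp : measurable_fun [set: m.-tuple Z * W]
    (fun q => (expR (catoni_exponent P A c q.1 q.2))%:E).
  apply/measurable_EFinP; apply: measurableT_comp => //.
  exact: measurable_catoni_exponent.
have exp0 (q : m.-tuple Z * W) : 0 <= (expR (catoni_exponent P A c q.1 q.2))%:E.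
  by rewrite lee_fin expR_ge0.
apply: markov_event => //.
- exact: (measurable_fun_fubini_tonelli_F _ mexp exp0).
- by move=> S; apply: integral_ge0 => w _; rewrite lee_fin expR_ge0.
rewrite (fubini_tonelli _ mexp exp0)/=.
rewrite -[leRHS](integral_probability_cst nu 1).
apply: ge0_le_integral => //.
- by move=> w _; apply: integral_ge0 => S _; rewrite lee_fin expR_ge0.
- exact: (measurable_fun_fubini_tonelli_G _ mexp exp0).
move=> w _; under eq_integral do rewrite expR_sum.
have mAw : measurable_fun [set: Z] (fun z => A (w, z)).
  exact: (measurable_fun_pair2 w mA).
apply: (integral_iid_prod_le1 (g := fun z => expR ((1 - expR (- c)) *
   fine (P [set z | A (w, z)]) - c * (A (w, z))%:R))) => //.
  apply: measurableT_comp => //; apply: measurable_funB => //.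
  by apply: measurable_funM => //; exact: measurable_natr_bool.
exact: integral_expR_bernoulli_le1.
Qed.

End catoni_bound.

(** On the event of [catoni_event] for [pi \x pi], the change of measure with [K = e^-1] holds for
    every [rho] at once. *)
Lemma pac_bayes_pair dZ (Z : measurableType dZ) dV (V : measurableType dV)
    (R : realType) (P : probability Z R) (pi : probability V R)
    (A : (V * V) * Z -> bool) (m : nat) (c e : R) :
  measurable_fun [set: (V * V) * Z] A -> (0 < m)%N -> (0 < c)%R -> (0 < e)%R ->
  exists E, [/\ measurable E, (1 - e)%:E <= iid P m E &
    forall S, E S -> forall rho : probability V R,
      \int[rho \x rho]_w P [set z | A (w, z)] <=
      (c / (1 - expR (- c)))%:E *
        ((m%:R^-1)%:E *
           (\sum_(i < m) \int[rho \x rho]_w (A (w, tnth S i))%:R%:E) +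
         ((m%:R * c)^-1)%:E * (2%:E * KL rho pi + (ln e^-1)%:E))].
Proof.
move=> mA m0 c0 e0.
have [E [mE PE intE]] := catoni_event P (pi \x pi) m c mA e0.
exists E; split=> // S ES rho.
set k : R := (1 - expR (- c))%R.
have k0 : (0 < k)%R by rewrite subr_gt0 expR_lt1 oppr_lt0.
have mR0 : (0 < m%:R :> R)%R by rewrite ltr0n.
have mAw w : measurable_fun [set: Z] (fun z => A (w, z)).
  exact: (measurable_fun_pair2 w mA).
have mAz z : measurable_fun [set: V * V] (fun w => A (w, z)).
  exact: (measurable_fun_pair1 z mA).
have PAE w : P [set z | A (w, z)] = (fine (P [set z | A (w, z)]))%:E.
  by rewrite fineK// fin_num_measure//; exact: measurable_bool_set.
pose p w := fine (P [set z | A (w, z)]).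
have intp : (rho \x rho).-integrable [set: V * V] (EFin \o p).
  apply: (@bounded_integrable _ _ _ (rho \x rho) _ 1).
    apply: (measurableT_comp (fine_measurable measurableT)).
    exact: measurable_prob_section.
  move=> w; rewrite ger0_norm ?fine_ge0// -lee_fin -PAE probability_le1//.
  exact: measurable_bool_set.
have intA i : (rho \x rho).-integrable [set: V * V]
    (EFin \o (fun w => (A (w, tnth S i))%:R)).
  apply: (@bounded_integrable _ _ _ (rho \x rho) _ 1).
    exact: measurable_natr_bool.
  by move=> w; case: (A _); rewrite ?normr1 ?normr0.
pose D := fine (\int[rho \x rho]_w (p w)%:E).
pose I i := fine (\int[rho \x rho]_w (A (w, tnth S i))%:R%:E).
have DE : \int[rho \x rho]_w (p w)%:E = D%:E.
  by rewrite fineK//; exact: integrable_fin_num.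
have IE i : \int[rho \x rho]_w (A (w, tnth S i))%:R%:E = (I i)%:E.
  by rewrite fineK//; apply: integrable_fin_num => //; exact: intA.
have mexp : measurable_fun [set: V * V] (catoni_exponent P A c S).
  exact: (measurable_fun_pair2 S (measurable_catoni_exponent P c mA)).
have := change_of_measure_pair rho mexp
  (fun w => catoni_exponent_bounded P c S w mA) _ (intE _ ES).
rewrite invr_gt0 => /(_ e0).
(* By linearity the exponent integrates to [m k D - c * sum I]; the bound follows by solving for
   [D]. *)
have -> : \int[rho \x rho]_w (catoni_exponent P A c S w)%:E =
    (m%:R * (k * D) - c * \sum_(i < m) I i)%:E.
  under eq_integral do rewrite /catoni_exponent -sumEFin.
  rewrite integral_sum//=; last first.
    move=> i; apply: (integrableB measurableT
      (integrableZl measurableT k intp) (integrableZl measurableT c (intA i))).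
  rewrite (eq_bigr (fun i => (k * D - c * I i)%:E)); last first.
    move=> i _; rewrite (integralB measurableT
      (integrableZl measurableT k intp) (integrableZl measurableT c (intA i))).
    by rewrite !integralZl//= DE IE.
  rewrite sumEFin sumrB sumr_const card_ord -mulr_sumr.
  by rewrite mulr_natl.
rewrite (eq_integral (EFin \o p)); last by move=> w _; rewrite PAE.
rewrite DE (eq_bigr (fun i => (I i)%:E)); last by move=> i _; exact: IE.
rewrite sumEFin; case: (KL rho pi) (KL_ge0 rho pi) => [kl| |]// _.
  rewrite lee_fin => H; rewrite lee_fin.
  rewrite mulrAC ler_pdivlMr//.
  have -> : (c * (m%:R^-1 * (\sum_(i < m) I i) +
      (m%:R * c)^-1 * (2 * kl + ln e^-1)) =
      (c * (\sum_(i < m) I i) + (2 * kl + ln e^-1)) / m%:R)%R.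
    by field; rewrite !gt_eqF.
  have -> : (D * k = (m%:R * (k * D)) / m%:R)%R by field; rewrite gt_eqF.
  by rewrite ler_pM2r ?invr_gt0// -lerBlDl.
(* An infinite [KL] makes the right side [+oo]: its coefficients are strictly positive, so no
   product [0 * +oo = 0] occurs. *)
move=> _; rewrite mulry gtr0_sg// mul1e addye//.
rewrite mulry gtr0_sg ?invr_gt0 ?mulr_gt0//.
by rewrite mul1e addey// mulry gtr0_sg ?divr_gt0// mul1e leey.
Qed.

(** * Disagreement, joint error and the Gibbs risk *)

Lemma measurable_neq_bool d (T : measurableType d) (f g : T -> bool) :
  measurable_fun [set: T] f -> measurable_fun [set: T] g ->
  measurable_fun [set: T] (fun x => f x != g x).
Proof.
move=> mf mg; rewrite (_ : (fun x => _) =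
    (fun x => if f x then ~~ g x else g x)).
  by apply: measurable_fun_ifT => //; exact: measurable_neg.
by apply/funext => x; case: (f x); case: (g x).
Qed.

Section gibbs_risk_pair.
Context dX (X : measurableType dX) dV (V : measurableType dV) (R : realType).
Variables (ev : V -> X -> bool).
Hypothesis mev : measurable_fun [set: V * X] (fun hx => ev hx.1 hx.2).

(** Grouping the two voters in the first component makes this and [pair_errs] instances of the loss
    [A] of [pac_bayes_pair]. Disagreement ignores labels, so an unlabelled target sample estimates
    it. *)
Definition pair_disagrees (q : (V * V) * X) : bool :=
  ev q.1.1 q.2 != ev q.1.2 q.2.

Definition pair_errs (q : (V * V) * (X * bool)) : bool :=
  (ev q.1.1 q.2.1 != q.2.2) && (ev q.1.2 q.2.1 != q.2.2).

Lemma measurable_ev_comp d (T : measurableType d) (f : T -> V) (g : T -> X) :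
  measurable_fun [set: T] f -> measurable_fun [set: T] g ->
  measurable_fun [set: T] (fun x => ev (f x) (g x)).
Proof.
by move=> mf mg; exact: (measurableT_comp mev (measurable_fun_pair mf mg)).
Qed.

Lemma measurable_pair_disagrees :
  measurable_fun [set: (V * V) * X] pair_disagrees.
Proof.
by apply: measurable_neq_bool; apply: measurable_ev_comp => //;
  apply: measurableT_comp.
Qed.

Lemma measurable_errs :
  measurable_fun [set: V * (X * bool)] (fun q => ev q.1 q.2.1 != q.2.2).
Proof.
apply: measurable_neq_bool; last exact: measurableT_comp.
by apply: measurable_ev_comp => //; apply: measurableT_comp.
Qed.

Lemma measurable_pair_errs :
  measurable_fun [set: (V * V) * (X * bool)] pair_errs.
Proof.
apply: measurable_and.
  exact: (measurableT_comp measurable_errs (measurable_fun_pair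
    (measurableT_comp measurable_fst measurable_fst) measurable_snd)).
exact: (measurableT_comp measurable_errs (measurable_fun_pair
  (measurableT_comp measurable_snd measurable_fst) measurable_snd)).
Qed.

End gibbs_risk_pair.

Section gibbs_risk_decomposition.
Context dX (X : measurableType dX) dV (V : measurableType dV) (R : realType).
Variables (ev : V -> X -> bool).
Hypothesis mev : measurable_fun [set: V * X] (fun hx => ev hx.1 hx.2).

Let err h (z : X * bool) := ev h z.1 != z.2.

Lemma measurable_err h : measurable_fun [set: X * bool] (err h).
Proof. exact: (measurable_fun_pair2 h (measurable_errs mev)). Qed.

(* [1{a} + 1{b} = 1{a xor b} + 2 1{a and b}], integrated over two independent
   voters. *)
Lemma gibbs_riskE (P : probability (X * bool)%type R) (rho : probability V R) :
  gibbs_risk ev P rho =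
    (2^-1)%:E * \int[rho \x rho]_w marginal P [set x | pair_disagrees ev (w, x)]
    + \int[rho \x rho]_w P [set z | pair_errs ev (w, z)].
Proof.
have mBR h : measurable_fun [set: X * bool] (fun z => (err h z)%:R%:E : \bar R).
  by apply/measurable_EFinP/measurable_natr_bool; exact: measurable_err.
pose r h := P [set z | err h z].
have rE h : r h = \int[P]_z (err h z)%:R%:E.
  by rewrite integral_bool//; exact: measurable_err.
have mB : measurable_fun [set: V * (X * bool)]
    (fun q => (err q.1 q.2)%:R%:E : \bar R).
  by apply/measurable_EFinP/measurable_natr_bool; exact: measurable_errs.
have B0 (q : V * (X * bool)) : 0 <= (err q.1 q.2)%:R%:E :> \bar R.
  by rewrite lee_fin.
have mr : measurable_fun [set: V] r.
  exact: (measurable_prob_section P (measurable_errs mev)).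
have gE : gibbs_risk ev P rho = \int[rho]_h r h.
  rewrite /gibbs_risk -(fubini_tonelli _ mB B0).
  by apply: eq_integral => h _; rewrite rE.
have r0 h : 0 <= r h by exact: measure_ge0.
have mr1 : measurable_fun [set: V * V] (fun w => r w.1).
  exact: (measurableT_comp mr measurable_fst).
have mr2 : measurable_fun [set: V * V] (fun w => r w.2).
  exact: (measurableT_comp mr measurable_snd).
(* The risk is the mean error of either voter of an independent pair; adding both expressions brings
   in the pointwise identity [pairE]. *)
have g1 : gibbs_risk ev P rho = \int[rho \x rho]_w r w.1.
  rewrite (fubini_tonelli1 _ mr1)// gE; apply: eq_integral => h _.
  by rewrite /fubini_F/= integral_cst// -[LHS]mule1 -(probability_setT rho).
have g2 : gibbs_risk ev P rho = \int[rho \x rho]_w r w.2.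
  by rewrite (fubini_tonelli1 _ mr2)// /fubini_F/= integral_cst//
    -[LHS]mule1 -(probability_setT rho) gE.
pose D w := marginal P [set x | pair_disagrees ev (w, x)].
pose J w := P [set z | pair_errs ev (w, z)].
have mdis w : measurable_fun [set: X] (fun x => pair_disagrees ev (w, x)).
  exact: (measurable_fun_pair2 w (measurable_pair_disagrees mev)).
have mdis' w :
    measurable_fun [set: X * bool] (fun z => pair_disagrees ev (w, z.1)).
  exact: (measurableT_comp (mdis w) measurable_fst).
have merrs w : measurable_fun [set: X * bool] (fun z => pair_errs ev (w, z)).
  exact: (measurable_fun_pair2 w (measurable_pair_errs mev)).
have mD : measurable_fun [set: V * V] D.
  exact: (measurable_prob_section _ (measurable_pair_disagrees mev)).
have mJ : measurable_fun [set: V * V] J.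
  exact: (measurable_prob_section _ (measurable_pair_errs mev)).
have pairE w : r w.1 + r w.2 = D w + 2%:E * J w.
  (* A marginal probability is the [P]-probability of the preimage under [fst], which puts all terms
     under one integral. *)
  have -> : D w = \int[P]_z (pair_disagrees ev (w, z.1))%:R%:E.
    by rewrite integral_bool.
  rewrite /J -integral_bool// !rE -ge0_integralD//.
  rewrite -ge0_integralZl//; last first.
    by apply/measurable_EFinP/measurable_natr_bool.
  rewrite -ge0_integralD//.
  - apply: eq_integral => z _.
    rewrite -EFinM -!EFinD /pair_errs /pair_disagrees /err/=; congr (_%:E).
    by case: (ev w.1 z.1); case: (ev w.2 z.1); case: z.2 => /=; ring.
  - by apply/measurable_EFinP/measurable_natr_bool.
  - by apply: measurable_funeM; apply/measurable_EFinP/measurable_natr_bool.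
have two : gibbs_risk ev P rho + gibbs_risk ev P rho =
    \int[rho \x rho]_w D w + 2%:E * \int[rho \x rho]_w J w.
  rewrite {1}g1 g2 -ge0_integralD//.
  rewrite (eq_integral (fun w => D w + 2%:E * J w)); last first.
    by move=> w _; exact: pairE.
  rewrite ge0_integralD//; first by rewrite ge0_integralZl.
    by move=> w _; rewrite mule_ge0// measure_ge0.
  exact: measurable_funeM.
rewrite -/(D _) -/(J _).
have half : gibbs_risk ev P rho =
    (2^-1)%:E * (gibbs_risk ev P rho + gibbs_risk ev P rho).
  have gr0 : 0 <= gibbs_risk ev P rho.
    by rewrite gE; exact: integral_ge0.
  rewrite -[X in _ * (X + _)]mul1e -[X in _ * (_ + X)]mul1e -ge0_muleDl//.
  by rewrite muleA -EFinD -EFinM mulVf ?mul1e.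
rewrite half two ge0_muleDr; last 2 first.
- exact: integral_ge0.
- by rewrite mule_ge0//; exact: integral_ge0.
by rewrite muleA -EFinM mulVf ?mul1e.
Qed.

End gibbs_risk_decomposition.

(** * Transfer from source to target *)

Lemma mnormalizeE d (T : measurableType d) (R : realType)
    (mu : {measure set T -> \bar R}) (P : probability T R) (A : set T) :
  mu [set: T] != 0 -> mu [set: T] != +oo ->
  mnormalize mu P A = mu A * (fine (mu [set: T]))^-1%:E.
Proof. by rewrite /mnormalize => /negPf-> /negPf->. Qed.

Section source_to_target.
Context dX (X : measurableType dX) (R : realType).
Variables (mu : {measure set (X * bool) -> \bar R}).
Variables (S T : probability (X * bool)%type R).
Variables (s t : {mfun (X * bool)%type >-> R}).
Hypotheses (S_s : is_density mu S s) (T_t : is_density mu T t).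

Lemma density_setC_supp (P : probability (X * bool)%type R)
    (p : {mfun (X * bool)%type >-> R}) :
  is_density mu P p -> P (~` supp p) = 0.
Proof.
move=> [p0 ->]; last exact/measurableC/measurable_supp.
apply: integral0_eq => z /= /negP; rewrite -leNgt => pz.
by apply/eqP; rewrite eqe eq_le pz p0.
Qed.

(** A supremum over the empty set would be [-oo]; but an empty [supp s] would give [S] total mass
    0. *)
Lemma beta_oo_ge0 : 0 <= beta_oo t s.
Proof.
have [z sz] : exists z, supp s z.
  apply: contrapT => /forallNP s0.
  have := density_setC_supp S_s; rewrite (_ : ~` supp s = setT).
    by rewrite probability_setT => /eqP; rewrite onee_eq0.
  by apply/seteqP; split => // z _; exact: s0.
apply: (@le_trans _ _ (t z / s z)%:E).
  by rewrite lee_fin divr_ge0 ?(proj1 T_t) ?(proj1 S_s).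
by apply: ereal_sup_ubound; exists z.
Qed.

(** On [supp s] the densities satisfy [t <= beta_oo t s * s] pointwise, and both are taken with
    respect to the same [mu]. *)
Lemma target_le_source (E : set (X * bool)) : measurable E ->
  beta_oo t s \is a fin_num -> T (E `&` supp s) <= beta_oo t s * S E.
Proof.
move=> mE bfin; have mEs := measurableI _ _ mE (measurable_supp s).
apply: (@le_trans _ _ (beta_oo t s * S (E `&` supp s))); last first.
  apply: lee_wpmul2l; first exact: beta_oo_ge0.
  by apply: le_measure; rewrite ?inE//; exact: subIsetl.
rewrite (proj2 T_t)// (proj2 S_s)// -(fineK bfin).
rewrite -ge0_integralZl//; last 3 first.
- by apply/measurable_EFinP; exact: measurable_funTS.
- by move=> z _; rewrite lee_fin (proj1 S_s).
- by rewrite lee_fin fine_ge0// beta_oo_ge0.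
apply: ge0_le_integral => //.
- by move=> z _; rewrite lee_fin (proj1 T_t).
- by apply/measurable_EFinP; exact: measurable_funTS.
- by apply: measurable_funeM; apply/measurable_EFinP; exact: measurable_funTS.
move=> z [_ sz]; rewrite fineK// -lee_pdivrMr//.
by rewrite -EFinM; apply: ereal_sup_ubound; exists z.
Qed.

(** The left side is the mass of [T] off [supp s] times the risk of [h] under the conditional
    distribution, and that risk is one of those in the supremum. *)
Lemma target_off_source (H : set (X -> bool)) (h : X -> bool) : H h ->
  measurable_fun [set: X * bool] (fun z => h z.1 != z.2) ->
  T ([set z | h z.1 != z.2] `\` supp s) <= eta_minus T t s H.
Proof.
move=> Hh mh; set B := [set z | _].
have mB : measurable B by exact: measurable_bool_set.
have ms := measurable_supp s; have mt := measurable_supp t.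
(* [T] does not charge the complement of [supp t], so conditioning on [supp t] minus [supp s]
   amounts to conditioning off [supp s]. *)
have restr A : measurable A -> T (A `\` supp s) = T (A `&` (supp t `\` supp s)).
  move=> mA; have mAs : measurable (A `\` supp s) by exact: measurableD.
  rewrite (measureDI T mAs mt) [X in X + _](_ : _ = 0) ?add0e.
    by congr (T _); apply/seteqP; split => z [] => [[]|? []].
  apply: (@subset_measure0 _ _ _ T _ (~` supp t)).
  - exact: measurableD.
  - exact: measurableC.
  - by move=> z [].
  - exact: density_setC_supp T_t.
have Tfin : T (~` supp s) \is a fin_num.
  by rewrite fin_num_measure//; exact: measurableC.
(* With no mass off [supp s] the conditional distribution is a default value, but both sides are
   0. *)
have [T0|T0] := eqVneq (T (~` supp s)) 0.
  rewrite /eta_minus T0 mul0e -T0; apply: le_measure; rewrite ?inE.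
  - exact: measurableD.
  - exact: measurableC.
  - by move=> z [].
have TN : T (supp t `\` supp s) = T (~` supp s).
  by have := restr _ (@measurableT _ _); rewrite setTI setTD.
have rE : risk (target_minus_source T t s) h =
    T (B `\` supp s) * (fine (T (~` supp s)))^-1%:E.
  rewrite /risk integral_bool// -/B restr//.
  pose nu : {measure set (X * bool) -> \bar R} :=
    mrestr T (measurableD (measurable_supp t) (measurable_supp s)).
  have nuT : nu setT = T (~` supp s) by rewrite -TN -[in RHS](setTI (_ `\` _)).
  rewrite -nuT; apply: (@mnormalizeE _ _ _ nu T B); rewrite nuT//.
  by rewrite lt_eqF// ltey_eq Tfin.
rewrite /eta_minus.
apply: (@le_trans _ _ (T (~` supp s) * risk (target_minus_source T t s) h));
  last first.
  by apply: lee_wpmul2l => //; apply: ereal_sup_ubound; exists h.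
rewrite rE muleCA -{1}(fineK Tfin) -EFinM divff ?mule1//.
by rewrite fine_eq0.
Qed.

End source_to_target.

(** * Assembly of the bound *)

Lemma empirical_mean_fin d (W : measurableType d) (R : realType) (m : nat)
    (Q : probability W R) (A : 'I_m -> W -> bool) :
  (forall i, measurable_fun [set: W] (A i)) ->
  exists2 x : R, (0 <= x)%R &
    (m%:R^-1)%:E * \sum_(i < m) \int[Q]_w (A i w)%:R%:E = x%:E.
Proof.
move=> mA; exists (m%:R^-1 * \sum_(i < m) fine (Q [set w | A i w]))%R.
  by rewrite mulr_ge0 ?invr_ge0// sumr_ge0// => i _; exact: fine_ge0.
rewrite EFinM -sumEFin; congr (_ * _); apply: eq_bigr => i _.
rewrite integral_bool// fineK// fin_num_measure//.
exact: measurable_bool_set.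
Qed.

(** The extended-real arithmetic of the conclusion: [D] and [J] stand for target disagreement and
    joint error, [I] for the source joint error, [x] and [y] for the empirical means. If [kl],
    [beta] or [eta] is infinite the right side is [+oo]; otherwise everything is real. *)
Lemma combine_bounds (R : realType) (kb kc ub uc L x y : R)
    (beta eta kl D I J : \bar R) :
  (0 < kb)%R -> (0 < kc)%R -> (0 < ub)%R -> (0 < uc)%R -> (0 < L)%R ->
  (0 <= x)%R -> (0 <= y)%R -> 0 <= beta -> 0 <= eta -> 0 <= kl ->
  0 <= D -> 0 <= I -> 0 <= J ->
  D <= kc%:E * (x%:E + uc%:E * (2%:E * kl + L%:E)) ->
  I <= kb%:E * (y%:E + ub%:E * (2%:E * kl + L%:E)) ->
  (beta \is a fin_num -> J <= beta * I + eta) ->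
  (2^-1)%:E * D + J <=
    kc%:E * (2^-1)%:E * x%:E + kb%:E * beta * y%:E + eta +
    (kc%:E * uc%:E + kb%:E * beta * ub%:E) * (2%:E * kl + L%:E).
Proof.
move=> kb0 kc0 ub0 uc0 L0 x0 y0 beta0 eta0 kl0 D0 I0 J0.
have pos : 0 <= kc%:E * (2^-1)%:E * x%:E + kb%:E * beta * y%:E + eta.
  by rewrite !adde_ge0// ?mule_ge0// lee_fin ltW.
have top (a : \bar R) : (kc%:E * uc%:E + kb%:E * beta * ub%:E) *
    (2%:E * kl + L%:E) = +oo ->
  a <= kc%:E * (2^-1)%:E * x%:E + kb%:E * beta * y%:E + eta +
    (kc%:E * uc%:E + kb%:E * beta * ub%:E) * (2%:E * kl + L%:E).
  by move=> ->; rewrite addey ?leey// -ltNye (lt_le_trans _ pos)// ltNyr.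
(* Strict positivity of both factors ensures that an infinite [beta] or [kl] makes their product
   [+oo]. *)
have Q0 : 0 < 2%:E * kl + L%:E.
  by rewrite (@lt_le_trans _ _ L%:E)// leeDr// mule_ge0.
have U0 : 0 < kc%:E * uc%:E + kb%:E * beta * ub%:E.
  rewrite -EFinM (@lt_le_trans _ _ (kc * uc)%:E) ?lte_fin ?mulr_gt0//.
  by rewrite leeDl// !mule_ge0// lee_fin ltW.
case: kl kl0 pos top Q0 => [kl| |]// kl0 pos top Q0; last first.
  by move=> *; apply: top; rewrite mulry gtr0_sg// mul1e addye// gt0_muley.
case: beta beta0 pos top U0 => [beta| |]// beta0 pos top U0; last first.
  move=> *; apply: top; rewrite mulry gtr0_sg// mul1e mulyr gtr0_sg// mul1e.
  by rewrite addey// gt0_mulye.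
pose Q : R := (2 * kl + L)%R.
have {Q0} Q0 : (0 < Q)%R by rewrite -lte_fin.
rewrite -[kc%:E * (x%:E + _)]/((kc * (x + uc * Q))%:E).
rewrite -[kb%:E * (y%:E + _)]/((kb * (y + ub * Q))%:E).
rewrite -[kc%:E * _ * _ + _]/((kc * 2^-1 * x + kb * beta * y)%:E).
rewrite -[(_ + _) * _]/(((kc * uc + kb * beta * ub) * Q)%:E).
case: D D0 => [D| |]// D0; rewrite ?leye_eq//.
case: I I0 => [I| |]// I0; rewrite ?leye_eq//.
rewrite !lee_fin => HD HI /(_ isT).
case: eta eta0 pos top => [eta| |]// eta0 pos top; last first.
  by move=> _; rewrite addey// addye// leey.
case: J J0 => [J| |]// J0 HJ.
have {HJ} HJ : (J <= beta * I + eta)%R by rewrite -lee_fin.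
suff : (2^-1 * D + J <= kc * 2^-1 * x + kb * beta * y + eta +
    (kc * uc + kb * beta * ub) * Q)%R by rewrite -lee_fin.
rewrite lee_fin in beta0.
have HbI := ler_wpM2l beta0 HI.
(* Halving the bound on [D] uses only half of this term; the claim contains all of it. *)
have Quc : (0 <= kc * uc * Q)%R by rewrite !mulr_ge0// ltW.
lra.
Qed.

Section domain_adaptation.
Context dX (X : measurableType dX) dV (V : measurableType dV) (R : realType).
Variables (ev : V -> X -> bool) (H : set (X -> bool)).
Hypothesis mev : measurable_fun [set: V * X] (fun hx => ev hx.1 hx.2).
Hypothesis evH : forall v, H (ev v).
Variables (mu : {measure set (X * bool) -> \bar R}).
Variables (S T : probability (X * bool)%type R).
Variables (s t : {mfun (X * bool)%type >-> R}).
Hypotheses (S_s : is_density mu S s) (T_t : is_density mu T t).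

Lemma emp_disagreementE (m : nat) (U : m.-tuple X) (rho : probability V R) :
  emp_disagreement ev U rho = (m%:R^-1)%:E *
    \sum_(i < m) \int[rho \x rho]_w (pair_disagrees ev (w, tnth U i))%:R%:E.
Proof.
congr (_ * _); apply: eq_bigr => i _; rewrite fubini_tonelli1//.
apply/measurable_EFinP; apply: measurable_natr_bool.
exact: (measurable_fun_pair1 _ (measurable_pair_disagrees mev)).
Qed.

Lemma emp_joint_errorE (m : nat) (U : m.-tuple (X * bool)%type)
    (rho : probability V R) :
  emp_joint_error ev U rho = (m%:R^-1)%:E *
    \sum_(i < m) \int[rho \x rho]_w (pair_errs ev (w, tnth U i))%:R%:E.
Proof.
congr (_ * _); apply: eq_bigr => i _; rewrite fubini_tonelli1//.
- apply: eq_integral => h _; apply: eq_integral => h' _.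
  by rewrite -natrM mulnb.
- apply/measurable_EFinP; apply: measurable_natr_bool.
  exact: (measurable_fun_pair1 _ (measurable_pair_errs mev)).
Qed.

(** The point of [V] yields a member of [H], so the supremum is not over the empty set. *)
Lemma eta_minus_ge0 : 0 <= eta_minus T t s H.
Proof.
have := target_off_source s T_t (evH point) (measurable_err mev point).
by apply: le_trans.
Qed.

(** For fixed voters the joint error event is split along [supp s]: the density ratio bounds one
    piece, and the error of the first voter alone, hence [eta_minus], bounds the other. *)
Lemma joint_error_transfer (rho : probability V R) :
  beta_oo t s \is a fin_num ->
  \int[rho \x rho]_w T [set z | pair_errs ev (w, z)] <=
  beta_oo t s * (\int[rho \x rho]_w S [set z | pair_errs ev (w, z)]) +
  eta_minus T t s H.
Proof.
move=> bfin.
have mST (P : probability (X * bool)%type R) :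
    measurable_fun [set: V * V] (fun w => P [set z | pair_errs ev (w, z)]).
  exact: (measurable_prob_section P (measurable_pair_errs mev)).
have beta0 := beta_oo_ge0 S_s T_t.
have -> : eta_minus T t s H = \int[rho \x rho]_w (eta_minus T t s H).
  by rewrite integral_cst// -[LHS]mule1 -(probability_setT (rho \x rho)).
rewrite -ge0_integralZl// -ge0_integralD//; last 3 first.
- by move=> w _; rewrite mule_ge0// measure_ge0.
- by apply: measurable_funeM; exact: mST.
- by move=> w _; exact: eta_minus_ge0.
apply: ge0_le_integral => //.
  by apply: emeasurable_funD => //; apply: measurable_funeM; exact: mST.
move=> w _; set E := [set z | _].
have mE : measurable E.
  apply: measurable_bool_set.
  exact: (measurable_fun_pair2 w (measurable_pair_errs mev)).
rewrite (measureDI T mE (measurable_supp s)) addeC; apply: leeD.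
  exact: (target_le_source S_s T_t).
apply: le_trans (target_off_source s T_t (evH w.1) (measurable_err mev w.1)).
apply: le_measure; rewrite ?inE.
- by apply: measurableD => //; exact: measurable_supp.
- apply: measurableD; last exact: measurable_supp.
  exact: measurable_bool_set (measurable_err mev _).
- by move=> z [/andP[+ _] sz]; split.
Qed.

Lemma domain_adaptation_bound (pi : probability V R) (ms mt : nat)
    (delta b c : R) :
  (0 < ms)%N -> (0 < mt)%N -> (0 < delta)%R -> (delta <= 1)%R ->
  (0 < b)%R -> (0 < c)%R ->
  let b' : \bar R := (b / (1 - expR (- b)))%:E * beta_oo t s in
  let c' : \bar R := (c / (1 - expR (- c)))%:E in
  with_probability_at_least (iid S ms \x iid (marginal T) mt) (1 - delta)
    [set ST | forall rho : probability V R,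
      gibbs_risk ev T rho <=
        c' * (2^-1)%:E * emp_disagreement ev ST.2 rho
        + b' * emp_joint_error ev ST.1 rho
        + eta_minus T t s H
        + (c' * ((mt%:R * c)^-1)%:E + b' * ((ms%:R * b)^-1)%:E)
          * (2%:E * KL rho pi + (ln (2 / delta))%:E)].
Proof.
move=> ms0 mt0 d0 d1 b0 c0 b' c'.
(* Each of the two samples gets confidence [delta / 2], the origin of [ln (2 / delta)]. *)
have d20 : (0 < delta / 2)%R by rewrite divr_gt0.
have [ES [mES PES boundS]] :=
  pac_bayes_pair S pi (measurable_pair_errs mev) ms0 b0 d20.
have [ET [mET PET boundT]] :=
  pac_bayes_pair (marginal T) pi (measurable_pair_disagrees mev) mt0 c0 d20.
exists (ES `*` ET); split; first exact: measurableX.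
  rewrite [X in _ <= X](_ : _ = iid S ms ES * iid (marginal T) mt ET);
    last exact: product_measure1E.
  (* The samples are independent, and [(1 - delta / 2)^2 >= 1 - delta]. *)
  apply: (@le_trans _ _ ((1 - delta / 2)%:E * (1 - delta / 2)%:E)).
    by rewrite -EFinM lee_fin; nra.
  by apply: lee_pmul => //; rewrite lee_fin; lra.
move=> [U U'] [/= EU EU'] rho.
have {boundS} := boundS U EU rho.
have {boundT} := boundT U' EU' rho.
rewrite -emp_disagreementE -emp_joint_errorE invf_div.
rewrite gibbs_riskE//.
have [x x0 xE] : exists2 x : R, (0 <= x)%R & emp_disagreement ev U' rho = x%:E.
  rewrite emp_disagreementE.
  apply: (@empirical_mean_fin _ _ _ _ (rho \x rho)) => i.
  exact: (measurable_fun_pair1 _ (measurable_pair_disagrees mev)).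
have [y y0 yE] : exists2 y : R, (0 <= y)%R & emp_joint_error ev U rho = y%:E.
  rewrite emp_joint_errorE.
  apply: (@empirical_mean_fin _ _ _ _ (rho \x rho)) => i.
  exact: (measurable_fun_pair1 _ (measurable_pair_errs mev)).
rewrite xE yE.
have eta0 := eta_minus_ge0.
have beta0 := beta_oo_ge0 S_s T_t.
have kl0 := KL_ge0 rho pi.
have L0 : (0 < ln (2 / delta))%R.
  by rewrite ln_gt0// ltr_pdivlMr// mul1r; lra.
have kb0 : (0 < b / (1 - expR (- b)))%R.
  by rewrite divr_gt0// subr_gt0 expR_lt1 oppr_lt0.
have kc0 : (0 < c / (1 - expR (- c)))%R.
  by rewrite divr_gt0// subr_gt0 expR_lt1 oppr_lt0.
have ub0 : (0 < (ms%:R * b)^-1)%R by rewrite invr_gt0 mulr_gt0// ltr0n.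
have uc0 : (0 < (mt%:R * c)^-1)%R by rewrite invr_gt0 mulr_gt0// ltr0n.
move=> boundT boundS.
apply: (combine_bounds kb0 kc0 ub0 uc0 L0 x0 y0 beta0 eta0 kl0 _ _ _
  boundT boundS).
- exact: integral_ge0.
- exact: integral_ge0.
- exact: integral_ge0.
- exact: joint_error_transfer.
Qed.

End domain_adaptation.

Theorem theorem6 (R : realType) (d : nat) (X : set (d.-tuple R))
    (X0 : X !=set0)
    (mu : {measure set (input_space X0 * bool) -> \bar R})
    (S T : probability (input_space X0 * bool)%type R)
    (s t : {mfun (input_space X0 * bool)%type >-> R})
    (S_s : is_density mu S s) (T_t : is_density mu T t)
    (H : set (input_space X0 -> bool)) (H0 : H !=set0)
    (G : set (set (nonempty_subtype H0)))
    (measurable_vote : measurable_fun [set: voter_space G * input_space X0]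
       (fun hx => vote hx.1 hx.2))
    (pi : probability (voter_space G) R)
    (ms mt : nat) (ms_ge1 : (1 <= ms)%N) (mt_ge1 : (1 <= mt)%N)
    (delta b c : R) (delta_gt0 : (0 < delta)%R) (delta_le1 : (delta <= 1)%R)
    (b_gt0 : (0 < b)%R) (c_gt0 : (0 < c)%R) :
  let b' : \bar R := (b / (1 - expR (- b)))%:E * beta_oo t s in
  let c' : \bar R := (c / (1 - expR (- c)))%:E in
  with_probability_at_least (iid S ms \x iid (marginal T) mt) (1 - delta)
    [set ST | forall rho : probability (voter_space G) R,
      gibbs_risk (@vote _ H H0 G) T rho <=
        c' * (2^-1)%:E * emp_disagreement (@vote _ H H0 G) ST.2 rho
        + b' * emp_joint_error (@vote _ H H0 G) ST.1 rho
        + eta_minus T t s H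
        + (c' * ((mt%:R * c)^-1)%:E + b' * ((ms%:R * b)^-1)%:E)
          * (2%:E * KL rho pi + (ln (2 / delta))%:E)].
Proof.
apply: (@domain_adaptation_bound _ _ _ _ _ _ H measurable_vote _ mu) => //.
by move=> v; apply: set_valP.
Qed.
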